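(* Let $(G,\mathcal{U},\varphi)$ be a self-similar ultragraph. Then the following are equivalent: 1. $\mathcal{S}_{G,\mathcal{U}}$ is $E^*$-unitary; 2. $\mathcal{S}_{G,\mathcal{U}}$ is strongly $E^*$-unitary; 3. $(G,\mathcal{U},\varphi)$ is pseudo free.
   Context: **Ultragraphs.** An ultragraph $\mathcal{U}=(U^0,\mathcal{U}^1,r,s)$ consists of a set $U^0$ of vertices, a set $\mathcal{U}^1$ of edges and maps $r,s:\mathcal{U}^1\to P(U^0)\setminus\{\emptyset\}$ ($P$ = power set) such that $r(e)$ is a singleton for every $e$. Standing assumption: $\mathcal{U}$ is row-finite without sources, i.e. $\{e\in\mathcal{U}^1: r(e)=\{v\}\}$ is nonempty and finite for all $v\in U^0$. $\mathcal{U}^0$ denotes the smallest subset of $P(U^0)$ containing $\emptyset$, all $\{v\}$ ($v\in U^0$), all $s(e)$ ($e\in\mathcal{U}^1$), and closed under finite $\cap,\cup,\setminus$. A path of length $n\ge1$ is a sequence $\alpha=e_1\cdots e_n$ of edges with $r(e_{i+1})\subseteq s(e_i)$; $r(\alpha)=r(e_1)$, $s(\alpha)=s(e_n)$, $|\alpha|=n$; $\mathcal{U}^{\ge1}$ is the set of all such paths. Concatenation $\alpha\beta$ is defined when $r(\beta)\subseteq s(\alpha)$. **Self-similar ultragraph.** A triple $(G,\mathcal{U},\varphi)$ where $\mathcal{U}=(U^0,\mathcal{U}^1,r,s)$ is a row-finite ultragraph without sources, $G$ is a countable discrete group with identity $1_G$ acting on $U^0\sqcup\mathcal{U}^1$ by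 ultragraph automorphisms (bijections preserving $U^0$ and $\mathcal{U}^1$ with $r(g\cdot e)=g\cdot r(e)$, $s(g\cdot e)=g\cdot s(e)$, where $g\cdot A=\{g\cdot v:v\in A\}$), and $\varphi:G\times\mathcal{U}^1\to G$ satisfies $\varphi(gh,e)=\varphi(g,h\cdot e)\varphi(h,e)$ and $\varphi(g,e)\cdot s(e)\subseteq g\cdot s(e)$. Extend to paths inductively by $g\cdot(\alpha_1\alpha_2)=(g\cdot\alpha_1)(\varphi(g,\alpha_1)\cdot\alpha_2)$, $\varphi(g,\alpha_1\alpha_2)=\varphi(\varphi(g,\alpha_1),\alpha_2)$. **Pseudo free.** $\alpha\in\mathcal{U}^{\ge1}$ is strongly fixed by $g$ if $g\cdot\alpha=\alpha$ and $\varphi(g,\alpha)=1_G$. $(G,\mathcal{U},\varphi)$ is pseudo free if for every $g\in G\setminus\{1_G\}$ there are no paths in $\mathcal{U}^{\ge1}$ strongly fixed by $g$. **The inverse semigroup $\mathcal{S}_{G,\mathcal{U}}$.** Add a universal path $\omega$ of length zero with $\omega\omega=\omega$, $\omega\alpha=\alpha\omega=\alpha$, $s(\omega)=r(\omega)=U^0$, $g\cdot\omega=\omega$, $\varphi(g,\omega)=g$; put $\mathcal{U}^\sharp=\{\omega\}\cup\mathcal{U}^{\ge1}$. Let $\mathcal{S}_{G,\mathcal{U}}=\{(\alpha,A,g,\beta):\alpha,\beta\in\mathcal{U}^\sharp, A\in\mathcal{U}^0, g\in G, \emptyset\ne A\subseteq s(\alpha)\cap g\cdot s(\beta)\}\cup\{0\}$,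 where $0$ is a zero element, with inverse $(\alpha,A,g,\beta)^*=(\beta,g^{-1}\cdot A,g^{-1},\alpha)$, $0^*=0$, and product $(\alpha,A,g,\beta)(\gamma,B,h,\delta)$ equal to - $(\alpha(g\cdot\varepsilon),\ (g\cdot s(\varepsilon))\cap(\varphi(g,\varepsilon)\cdot B),\ \varphi(g,\varepsilon)h,\ \delta)$ if $\gamma=\beta\varepsilon$, $\varepsilon\in\mathcal{U}^{\ge1}$, $g\cdot r(\varepsilon)\subseteq A$; - $(\alpha,\ A\cap(g\varphi(h^{-1},\varepsilon)^{-1}h^{-1}\cdot s(\beta)),\ g\varphi(h^{-1},\varepsilon)^{-1},\ \delta(h^{-1}\cdot\varepsilon))$ if $\beta=\gamma\varepsilon$, $\varepsilon\in\mathcal{U}^{\ge1}$, $r(\varepsilon)\subseteq B$; - $(\alpha,A\cap(g\cdot B),gh,\delta)$ if $\gamma=\beta$ and $A\cap(g\cdot B)\neq\emptyset$; - $0$ otherwise. With these operations $\mathcal{S}_{G,\mathcal{U}}$ is taken to be an inverse semigroup with zero. **$E^*$-unitarity.** Let $\mathcal{S}$ be an inverse semigroup with zero, with natural order $s\le t$ iff $s=te$ for some idempotent $e$. $\mathcal{S}$ is $E^*$-unitary if every $s\in\mathcal{S}$ with $e\le s$ for some nonzero idempotent $e$ is itself idempotent. A prehomomorphism from $\mathcal{S}$ to a group $H$ is a map $\theta:\mathcal{S}\setminus\{0\}\to H$ with $\theta(st)=\theta(s)\theta(t)$ whenever $st\ne0$; it is idempotent pure if $\theta^{-1}(1_H)$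 is the set of (nonzero) idempotents of $\mathcal{S}$. Let $\sigma:\mathcal{S}\setminus\{0\}\to U(\mathcal{S})$ be the universal prehomomorphism to the universal group $U(\mathcal{S})$ (every prehomomorphism to a group factors uniquely through $\sigma$ via a group homomorphism). $\mathcal{S}$ is strongly $E^*$-unitary if $\sigma$ is idempotent pure. *)

(* Defs.v *)
From HB Require Import structures.
From mathcomp Require Import all_boot.
From mathcomp Require Import boolp classical_sets functions cardinality.

Set Implicit Arguments.
Unset Strict Implicit.
Unset Printing Implicit Defensive.

Local Open Scope classical_set_scope.
Local Open Scope group_scope.

Record ultragraph := Ultragraph {
  vertex : Type;
  edge : Type;
  rng : edge -> set vertex;
  src : edge -> set vertex;
  rng_singleton : forall e, exists v, rng e = [set v];
  src_nonempty : forall e, src e !=set0 }.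

Definition row_finite_without_sources (U : ultragraph) : Prop :=
  forall v : vertex U,
    [set e : edge U | rng e = [set v]] !=set0 /\
    finite_set [set e : edge U | rng e = [set v]].

Inductive gvertex (U : ultragraph) : set (set (vertex U)) :=
| gvertex_set0 : gvertex set0
| gvertex_set1 v : gvertex [set v]
| gvertex_src e : gvertex (src e)
| gvertexI A B : gvertex A -> gvertex B -> gvertex (A `&` B)
| gvertexU A B : gvertex A -> gvertex B -> gvertex (A `|` B)
| gvertexD A B : gvertex A -> gvertex B -> gvertex (A `\` B).

Section Paths.
Variable U : ultragraph.
Implicit Type p : seq (edge U).

(* Paths are sequences of edges; the empty sequence is the universal path
   omega, so that [++] is the concatenation of paths, omega included. *)
Definition is_sharp_path p : Prop :=
  sorted (fun e f : edge U => `[< rng f `<=` src e >]) p.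

Definition is_path p : Prop := is_sharp_path p /\ p <> [::].

Definition prng p : set (vertex U) := if p is e :: _ then rng e else setT.

Definition psrc p : set (vertex U) :=
  if p is e :: q then src (last e q) else setT.

End Paths.

(* An action on the disjoint union of vertices and edges that preserves both
   parts is a pair of actions; each [actv g], [acte g] is then bijective. *)
Record self_similar (G : groupType) (U : ultragraph) := SelfSimilar {
  ss_row_finite : row_finite_without_sources U;
  ss_countable : countable [set: G];
  actv : G -> vertex U -> vertex U;
  acte : G -> edge U -> edge U;
  coc : G -> edge U -> G;
  actv1 : forall v, actv 1 v = v;
  actvM : forall g h v, actv (g * h) v = actv g (actv h v);
  acte1 : forall e, acte 1 e = e;
  acteM : forall g h e, acte (g * h) e = acte g (acte h e);
  acte_rng : forall g e, rng (acte g e) = actv g @` rng e;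
  acte_src : forall g e, src (acte g e) = actv g @` src e;
  cocM : forall g h e, coc (g * h) e = coc g (acte h e) * coc h e;
  coc_src : forall g e, actv (coc g e) @` src e `<=` actv g @` src e }.

Section SelfSimilarPaths.
Variables (G : groupType) (U : ultragraph) (X : self_similar G U).
Implicit Types (g h : G) (p q : seq (edge U)) (A B : set (vertex U)).

Definition acts g A : set (vertex U) := actv X g @` A.

Fixpoint actp g p : seq (edge U) :=
  if p is e :: q then acte X g e :: actp (coc X g e) q else [::].

Fixpoint cocp g p : G := if p is e :: q then cocp (coc X g e) q else g.

Lemma actp_cat g p q : actp g (p ++ q) = actp g p ++ actp (cocp g p) q.
Proof. by elim: p g => //= e p IH g; rewrite IH. Qed.

Lemma cocp_cat g p q : cocp g (p ++ q) = cocp (cocp g p) q.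
Proof. by elim: p g => //= e p IH g; rewrite IH. Qed.

Definition strongly_fixed g p : Prop := actp g p = p /\ cocp g p = 1.

Definition pseudo_free : Prop :=
  forall g, g <> 1 -> forall p, is_path p -> ~ strongly_fixed g p.

Lemma acts1 A : acts 1 A = A.
Proof.
rewrite /acts; apply/seteqP; split=> [_ [v Av <-]|v Av]; first by rewrite actv1.
by exists v => //; rewrite actv1.
Qed.

Lemma actsM g h A : acts (g * h) A = acts g (acts h A).
Proof.
rewrite /acts image_comp; apply: eq_imagel => v _ /=; exact: actvM.
Qed.

Lemma actsS g A B : A `<=` B -> acts g A `<=` acts g B.
Proof. exact: image_subset. Qed.

Lemma actsVK g A : acts g (acts g^-1 A) = A.
Proof. by rewrite -actsM mulgV acts1. Qed.

Lemma actsKV g A : acts g^-1 (acts g A) = A.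
Proof. by rewrite -actsM mulVg acts1. Qed.

Lemma actv_inj g : injective (actv X g).
Proof.
by move=> v w /(congr1 (actv X g^-1)); rewrite -!actvM mulVg !actv1.
Qed.

Lemma gvertex_acts g A : gvertex A -> gvertex (acts g A).
Proof.
have inj := @actv_inj g; rewrite /acts.
elim=> [|v|e|B C _ IB _ IC|B C _ IB _ IC|B C _ IB _ IC].
- by rewrite image_set0; exact: gvertex_set0.
- by rewrite image_set1; exact: gvertex_set1.
- by rewrite -acte_src; exact: gvertex_src.
- suff -> : actv X g @` (B `&` C) = actv X g @` B `&` actv X g @` C.
    exact: gvertexI.
  apply/seteqP; split=> [_ [v [Bv Cv] <-]|_ [[v Bv <-] [w Cw /inj wv]]].
    by split; exists v.
  by exists v => //; split=> //; rewrite -wv.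
- by rewrite image_setU; exact: gvertexU.
- suff -> : actv X g @` (B `\` C) = actv X g @` B `\` actv X g @` C.
    exact: gvertexD.
  apply/seteqP; split=> [_ [v [Bv Cv] <-]|_ [[v Bv <-] nC]].
    by split; [exists v|move=> [w Cw /inj wv]; apply: Cv; rewrite -wv].
  by exists v => //; split=> // Cv; apply: nC; exists v.
Qed.

Lemma coc1 e : coc X 1 e = 1.
Proof.
have := cocM X 1 1 e; rewrite mulg1 acte1 => /(congr1 (fun x => (coc X 1 e)^-1 * x)).
by rewrite mulgA mulVg mul1g => <-.
Qed.

Lemma coc_srcE g e : acts (coc X g e) (src e) = acts g (src e).
Proof.
apply/seteqP; split; first exact: coc_src.
have := @coc_src _ _ X g^-1 (acte X g e); rewrite acte_src => sub.
have E : coc X g^-1 (acte X g e) = (coc X g e)^-1.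
  have := cocM X g^-1 g e; rewrite mulVg coc1.
  by move=> /(congr1 (fun x => x * (coc X g e)^-1)); rewrite mul1g -mulgA mulgV mulg1.
have := @actsS (coc X g e) _ _ sub.
by rewrite E -/(acts _ _) -/(acts _ _) -/(acts _ _) actsVK actsKV.
Qed.

Lemma psrc_actp g p : p <> [::] -> psrc (actp g p) = acts (cocp g p) (psrc p).
Proof.
case: p => // e p _ /=; elim: p e g => [|f p IH] e g /=.
  by rewrite acte_src -/(acts _ _) coc_srcE.
exact: IH.
Qed.

Lemma prng_actp g p : p <> [::] -> prng (actp g p) = acts g (prng p).
Proof. by case: p => // e p _ /=; rewrite acte_rng. Qed.

Lemma psrc_cat p q : q <> [::] -> psrc (p ++ q) = psrc q.
Proof. by case: q => // e q _; case: p => //= f p; rewrite last_cat. Qed.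

Lemma is_sharp_path_catr p q : is_sharp_path (p ++ q) -> is_sharp_path q.
Proof.
case: q => // e q; case: p => //= f p; rewrite /is_sharp_path /= cat_path /=.
by move=> /and3P[].
Qed.

Lemma is_sharp_path_cat p q : is_sharp_path p -> is_sharp_path q ->
  prng q `<=` psrc p -> is_sharp_path (p ++ q).
Proof.
case: q => [|e q]; first by rewrite cats0.
case: p => //= f p; rewrite /is_sharp_path /= cat_path /= => -> -> sub.
by rewrite andbT; apply/asboolP.
Qed.

Lemma is_sharp_path_actp g p : is_sharp_path p -> is_sharp_path (actp g p).
Proof.
case: p => //= e p; rewrite /is_sharp_path /=.
elim: p e g => //= f p IH e g /andP[/asboolP sub fp].
rewrite IH // andbT; apply/asboolP; rewrite acte_rng acte_src.
rewrite -!/(acts _ _) -coc_srcE; exact: actsS.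
Qed.

End SelfSimilarPaths.

Section SGU.
Variables (G : groupType) (U : ultragraph) (X : self_similar G U).

Record quad := Quad {
  q_left : seq (edge U);
  q_set : set (vertex U);
  q_elt : G;
  q_right : seq (edge U) }.

Definition quad_valid (x : quad) : Prop :=
  let: Quad a A g b := x in
  [/\ is_sharp_path a, is_sharp_path b, gvertex A, A !=set0 &
      A `<=` psrc a `&` acts X g (psrc b)].

(* The path [eps] with [c = b ++ eps], if it exists, is
   [drop (size b) c]; [None] stands for the zero element. *)
Definition quad_mul (x y : quad) : option quad :=
  let: Quad a A g b := x in
  let: Quad c B h d := y in
  let e := drop (size b) c in
  let f := drop (size c) b in
  if `[< [/\ c = b ++ e, e <> [::] & acts X g (prng e) `<=` A] >] then
    Some (Quad (a ++ actp X g e)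
               (acts X g (psrc e) `&` acts X (cocp X g e) B)
               (cocp X g e * h)
               d)
  else if `[< [/\ b = c ++ f, f <> [::] & prng f `<=` B] >] then
    Some (Quad a
               (A `&` acts X (g * (cocp X h^-1 f)^-1 * h^-1) (psrc b))
               (g * (cocp X h^-1 f)^-1)
               (d ++ actp X h^-1 f))
  else if `[< c = b /\ A `&` acts X g B !=set0 >] then
    Some (Quad a (A `&` acts X g B) (g * h) d)
  else None.

Definition quad_star (x : quad) : quad :=
  let: Quad a A g b := x in Quad b (acts X g^-1 A) g^-1 a.

(* In the first case [acts X g (psrc e)] is the source of [actp X g e] when [e]
   is a single edge (see [coc_srcE]); for longer [e] the two sets may differ,
   and the set component of the product may then be empty. By the next lemma
   this is the only way in which a product can fail to be a valid quadruple;
   [sgu_of_quad] below maps it to zero. The second case is similar. *)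
Lemma quad_mul_valid x y z : quad_valid x -> quad_valid y ->
  quad_mul x y = Some z -> q_set z !=set0 -> quad_valid z.
Proof.
case: x y => [a A g b] [c B h d] /= [pa pb gA A0 sA] [pc pd gB B0 sB].
set e := drop _ c; set f := drop _ b.
case: asboolP => [[cE e0 re] [<-]|_] /=.
  have pe : is_sharp_path e by move: pc; rewrite cE; apply: is_sharp_path_catr.
  have ae0 : actp X g e <> [::] by case: (e) e0.
  have Ee : psrc c = psrc e by rewrite cE psrc_cat.
  move=> ne; split=> //.
  - apply: is_sharp_path_cat => //; first exact: is_sharp_path_actp.
    by rewrite prng_actp // => v /re /sA[].
  - apply: gvertexI; apply: gvertex_acts => //.
    by case: (e) e0 => // ? ? _ /=; exact: gvertex_src.
  - rewrite psrc_cat // psrc_actp // actsM -Ee.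
    by move=> v [_ Bv]; split; move: v Bv; apply: actsS => w /sB[].
case: asboolP => [[bE f0 rf] [<-]|_] /=.
  have pf : is_sharp_path f by move: pb; rewrite bE; apply: is_sharp_path_catr.
  have af0 : actp X h^-1 f <> [::] by case: (f) f0.
  have Ef : psrc b = psrc f by rewrite bE psrc_cat.
  move=> ne; split=> //.
  - apply: is_sharp_path_cat => //; first exact: is_sharp_path_actp.
    rewrite prng_actp //.
    have -> : psrc d = acts X h^-1 (acts X h (psrc d)) by rewrite actsKV.
    by apply: actsS => v /rf /sB[].
  - apply: gvertexI => //; apply: gvertex_acts; rewrite Ef.
    by case: (f) f0 => // ? ? _ /=; exact: gvertex_src.
  - rewrite psrc_cat // psrc_actp // -Ef -[acts X _ (acts X _ _)]actsM.
    by rewrite -[g * _ * cocp X _ _]mulgA mulVg mulg1 => v [/sA].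
case: asboolP => [[cE AB0] [<-]|_] //= _; split=> //.
- by apply: gvertexI => //; apply: gvertex_acts.
- move=> v [/sA[av _] Bv]; split=> //; rewrite actsM.
  by move: Bv; apply: (@actsS _ _ X g B) => w /sB[].
Qed.

Lemma quad_star_valid x : quad_valid x -> quad_valid (quad_star x).
Proof.
case: x => a A g b /= [pa pb gA [v Av] sA]; split=> //.
- exact: gvertex_acts.
- by exists (actv X g^-1 v); exists v.
- move=> w wA; split; last by move: w wA; apply: actsS => u /sA[].
  rewrite -(actsKV X g (psrc b)).
  by move: w wA; apply: actsS => u /sA[].
Qed.

Record sgu_nonzero := SguNonzero {
  sgu_quad :> quad;
  sgu_valid : quad_valid sgu_quad }.

(* [None] is the zero element. *)
Definition sgu : Type := option sgu_nonzero.

Definition sgu0 : sgu := None.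

Definition sgu_of_quad (x : quad) : sgu :=
  if pselect (quad_valid x) is left h then Some (SguNonzero h) else sgu0.

Definition sgu_mul (s t : sgu) : sgu :=
  if s is Some x then
    if t is Some y then
      if quad_mul x y is Some z then sgu_of_quad z else sgu0
    else sgu0
  else sgu0.

Definition sgu_star (s : sgu) : sgu :=
  if s is Some x then Some (SguNonzero (quad_star_valid (sgu_valid x)))
  else sgu0.

HB.instance Definition _ := hasMul.Build sgu sgu_mul.

End SGU.

Arguments sgu0 {G U} X.

(* [z] is the zero of [S]. A map out of [S \ {0}] is represented by a total map
   on [S] whose value at [z] is irrelevant. *)
Section EStarUnitary.
Variables (S : magmaType) (z : S).
Implicit Types s t e : S.

Definition idem s : Prop := s * s = s.

Definition natural_le s t : Prop := exists2 e, idem e & s = t * e.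

Definition Estar_unitary : Prop :=
  forall s e, idem e -> e <> z -> natural_le e s -> idem s.

Definition prehom (H : groupType) (theta : S -> H) : Prop :=
  forall s t, s * t <> z -> theta (s * t) = theta s * theta t.

Definition idempotent_pure (H : groupType) (theta : S -> H) : Prop :=
  forall s, s <> z -> (theta s = 1 <-> idem s).

Definition universal_prehom (V : groupType) (sigma : S -> V) : Prop :=
  prehom sigma /\
  forall (H : groupType) (theta : S -> H), prehom theta ->
  exists2 f : {multiplicative V -> H},
    (forall s, s <> z -> theta s = f (sigma s)) &
    forall f' : {multiplicative V -> H},
      (forall s, s <> z -> theta s = f' (sigma s)) -> f' =1 f.

Definition strongly_Estar_unitary : Prop :=
  exists (V : groupType) (sigma : S -> V),
    universal_prehom sigma /\ idempotent_pure sigma.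

End EStarUnitary.

(* Main.v *)
From HB Require Import structures.
Require Import Defs.
From mathcomp Require Import all_boot.
From mathcomp Require Import boolp classical_sets.

Set Implicit Arguments.
Unset Strict Implicit.
Unset Printing Implicit Defensive.

Local Open Scope group_scope.

(** The nonzero idempotents are the quadruples
   $(\alpha, A, 1, \alpha)$, and pseudo freeness is a condition on edges only:
   if $g \ne 1$ strongly fixes $e_1 \cdots e_n$, then some edge $e_i$ is
   strongly fixed by a nontrivial element, since the successive cocycle values
   start at $g$ and end at $1$ ([strongly_fixed_edge]).

   If $k \ne 1$ strongly fixes an edge $e$, then $t = (\omega, r(e), k, \omega)$
   is not idempotent, but it lies above the idempotent
   $f = (e, s(e), 1, e)$, because $t f = f$; so E*-unitarity implies pseudo
   freeness ([Estar_unitary_pseudo_free]).  That strong E*-unitarity implies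
   E*-unitarity holds in every magma with an absorbing zero: the universal map
   sends $e$ and $f$ to 1 when $e = t f$ is a nonzero idempotent and $f$ is
   idempotent, hence it sends $t$ to 1, and $t$ is idempotent by purity.

   The substance is in the remaining implication.  The universal group exists,
   and its map is idempotent pure as soon as some prehomomorphism to some group
   sends only idempotents to 1 ([strongly_Estar_unitary_of_pure]).  If a group
   $H$ contains images of $G$ and of the edges with $g e = (g \cdot e)
   \varphi(g, e)$, then $(\alpha, A, g, \beta) \mapsto \alpha g \beta^{-1}$ is a
   prehomomorphism ([sgu_val_prehom]).  It has the wanted property if the monoid
   $M$ of formal products $\alpha g$ (words in the edges times $G$) embeds in
   $H$, and pseudo freeness makes such an $H$ exist
   ([pseudo_free_realization]).

   To find $H$, let $M$ act on itself by left multiplication.  There $G$ acts by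
   bijections, but an edge only by an injection.  Enlarge $M$ to
   $Y = M \sqcup T \times G$, with $T$ a large set of labels for free
   $G$-orbits, and extend each edge to a bijection of $Y$.  All these bijections
   together are one bijection of $E \times Y$ over the edge set $E$ that is
   equivariant from $g (e, y) = (g e, \varphi(g, e) y)$ to
   $g (e, y) = (g e, g y)$.  Both actions are free, the first one by pseudo
   freeness, so each maps equivariantly and injectively into the part
   $E \times T \times G$ of the other.  This gives a backward injection, and,
   combined with left multiplication on $E \times M$, a forward one; the
   equivariant form of the Cantor-Bernstein theorem
   ([equivariant_Cantor_Bernstein]) then yields a bijection.  It still is left
   multiplication on $E \times M$, because the backward injection misses
   $E \times M$.  Finally the group of permutations of $Y$ serves as $H$: a
   product $\alpha g$ is recovered from the image of the unit of $M$. *)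

(** * The universal group of a magma with zero *)

Section UniversalGroup.
Variables (S : magmaType) (z : S).
Implicit Types (s t : S) (w : seq (bool * S)).

Section Evaluation.
Variables (H : groupType) (theta : S -> H).

Fixpoint word_eval w : H :=
  if w is (b, s) :: w' then
    (if b then (theta s)^-1 else theta s) * word_eval w'
  else 1.

Lemma word_eval_cat w1 w2 :
  word_eval (w1 ++ w2) = word_eval w1 * word_eval w2.
Proof. by elim: w1 => [|[b s] w1 IH] /=; rewrite ?mul1g // IH mulgA. Qed.

Definition word_inv w := rev [seq (~~ x.1, x.2) | x <- w].

Lemma word_eval_inv w : word_eval (word_inv w) = (word_eval w)^-1.
Proof.
rewrite /word_inv; elim: w => [|[b s] w IH] /=; first by rewrite invg1.
rewrite rev_cons -cats1 word_eval_cat IH /= mulg1 invgM.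
by case: b => /=; rewrite ?invgK.
Qed.

End Evaluation.

(** The universal group consists of formal words modulo equality under all
   prehomomorphisms.  Only those with value 1 at the zero are tested, so that
   the letter of the zero, about which a prehomomorphism says nothing, becomes
   trivial; otherwise uniqueness of the factorization would fail. *)
Definition word_equiv w1 w2 : Prop :=
  forall (H : groupType) (theta : S -> H),
    prehom z theta -> theta z = 1 -> word_eval theta w1 = word_eval theta w2.

Definition universal_group : Type :=
  {C : set (seq (bool * S)) | exists w, C = word_equiv w}.

Definition word_class w : universal_group :=
  exist _ (word_equiv w) (ex_intro _ w erefl).

Definition word_repr (C : universal_group) : seq (bool * S) :=
  sval (cid (svalP C)).

Lemma sval_inj (C D : universal_group) : sval C = sval D -> C = D.
Proof. by case: C D => [C wC] [D wD] /= CD; exact: eq_exist. Qed.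

Lemma word_class_eq w1 w2 : word_equiv w1 w2 -> word_class w1 = word_class w2.
Proof.
move=> E; apply: sval_inj; apply/predeqP => w; split=> Ew H theta pt tz.
  by rewrite -(E _ _ pt tz); exact: Ew.
by rewrite (E _ _ pt tz); exact: Ew.
Qed.

Lemma word_reprK C : word_class (word_repr C) = C.
Proof.
by apply: sval_inj; rewrite /word_repr; case: cid => /= w <-.
Qed.

Lemma word_class_repr w : word_equiv (word_repr (word_class w)) w.
Proof. by rewrite /word_repr; case: cid => /= w' Ew; rewrite -Ew. Qed.

Definition ug_mul (C D : universal_group) :=
  word_class (word_repr C ++ word_repr D).
Definition ug_inv (C : universal_group) := word_class (word_inv (word_repr C)).

Lemma ug_mulE w1 w2 :
  ug_mul (word_class w1) (word_class w2) = word_class (w1 ++ w2).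
Proof.
apply: word_class_eq => H theta pt tz.
by rewrite !word_eval_cat !(word_class_repr _ pt tz).
Qed.

Lemma ug_invE w : ug_inv (word_class w) = word_class (word_inv w).
Proof.
apply: word_class_eq => H theta pt tz.
by rewrite !word_eval_inv (word_class_repr _ pt tz).
Qed.

Lemma ug_mulA : associative ug_mul.
Proof.
move=> A B C; rewrite -(word_reprK A) -(word_reprK B) -(word_reprK C).
by rewrite !ug_mulE catA.
Qed.

Lemma ug_mul1g : left_id (word_class [::]) ug_mul.
Proof. by move=> A; rewrite -(word_reprK A) ug_mulE. Qed.

Lemma ug_mulg1 : right_id (word_class [::]) ug_mul.
Proof. by move=> A; rewrite -(word_reprK A) ug_mulE cats0. Qed.

Lemma ug_mulVg : left_inverse (word_class [::]) ug_inv ug_mul.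
Proof.
move=> A; rewrite -(word_reprK A) ug_invE ug_mulE; apply: word_class_eq.
by move=> H theta _ _; rewrite word_eval_cat word_eval_inv mulVg.
Qed.

Lemma ug_mulgV : right_inverse (word_class [::]) ug_inv ug_mul.
Proof.
move=> A; rewrite -(word_reprK A) ug_invE ug_mulE; apply: word_class_eq.
by move=> H theta _ _; rewrite word_eval_cat word_eval_inv mulgV.
Qed.

HB.instance Definition _ := gen_eqMixin universal_group.
HB.instance Definition _ := gen_choiceMixin universal_group.
HB.instance Definition _ := isGroup.Build universal_group
  ug_mulA ug_mul1g ug_mulg1 ug_mulVg ug_mulgV.

Definition universal_map s : universal_group := word_class [:: (false, s)].

(* A nonzero product has nonzero factors, so the value of a prehomomorphism at
   an absorbing zero can be changed freely. *)
Hypotheses (mul0s : forall s, z * s = z) (muls0 : forall s, s * z = z).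

Lemma prehom_normalize (H : groupType) (theta : S -> H) : prehom z theta ->
  prehom z (fun s => if `[< s = z >] then 1 else theta s).
Proof.
move=> pt s t st0; case: asboolP => // _; rewrite pt //.
case: asboolP => [sz|_]; first by case: st0; rewrite sz mul0s.
by case: asboolP => // tz; case: st0; rewrite tz muls0.
Qed.

Lemma universal_mapP : universal_prehom z universal_map.
Proof.
split=> [s t st0|H theta pt].
  rewrite [RHS]ug_mulE; apply: word_class_eq => H theta pt _ /=.
  by rewrite !mulg1 pt.
set theta1 := fun s => if `[< s = z >] then 1 else theta s.
have pt1 : prehom z theta1 by exact: prehom_normalize.
have t1z : theta1 z = 1 by rewrite /theta1; case: asboolP.
pose f (C : universal_group) := word_eval theta1 (word_repr C).
have fE w : f (word_class w) = word_eval theta1 w.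
  exact: (word_class_repr w pt1 t1z).
have fM : {morph f : x y / x * y}.
  move=> A B; rewrite -(word_reprK A) -(word_reprK B).
  by rewrite [word_class _ * _]ug_mulE !fE word_eval_cat.
pose fm := isMultiplicative.Build universal_group H f fM.
pose F : {multiplicative universal_group -> H} := HB.pack f fm.
have Fsig s : s <> z -> theta s = F (universal_map s).
  by move=> sz; rewrite [RHS]fE /= mulg1 /theta1; case: asboolP.
exists F => // f' f'E C.
(* Uniqueness: the classes of one-letter words generate. *)
have f'M : {morph f' : x y / x * y} by exact: gmulfM.
have f'1 : f' 1 = 1 by apply: (@mulgI _ (f' 1)); rewrite -f'M !mulg1.
have f'sig s : f' (universal_map s) = theta1 s.
  rewrite /theta1; case: asboolP => [->|sz]; last by rewrite -f'E.
  rewrite -f'1; congr (f' _); apply: word_class_eq => K eta _ ez /=.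
  by rewrite ez mulg1.
rewrite -(word_reprK C) [RHS]fE; elim: (word_repr C) => [|[b s] w IH] //=.
have -> : word_class ((b, s) :: w) = word_class [:: (b, s)] * word_class w.
  by rewrite [RHS]ug_mulE.
rewrite f'M IH -f'sig; congr (_ * _).
case: b => //; apply: (@mulgI _ (f' (universal_map s))).
rewrite mulgV -f'M -f'1; congr (f' _); rewrite [LHS]ug_mulE.
by apply: word_class_eq => K eta _ _ /=; rewrite mulg1 mulgV.
Qed.

Lemma prehom_idem (H : groupType) (theta : S -> H) s :
  prehom z theta -> s <> z -> idem s -> theta s = 1.
Proof.
move=> pt sz ss; apply: (@mulgI _ (theta s)).
by rewrite mulg1 -pt ss.
Qed.

(** Idempotent purity passes to the universal map: every other
   prehomomorphism factors through it, so it has the smallest kernel. *)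
Lemma strongly_Estar_unitary_of_pure (H : groupType) (theta : S -> H) :
  prehom z theta -> (forall s, s <> z -> theta s = 1 -> idem s) ->
  strongly_Estar_unitary z.
Proof.
move=> pt pure; exists universal_group, universal_map.
split; first exact: universal_mapP.
move=> s sz; split=> [s1|]; last exact: prehom_idem universal_mapP.1 sz.
have [f fE _] := universal_mapP.2 _ _ pt.
apply: pure => //; rewrite fE // s1.
by apply: (@mulgI _ (f 1)); rewrite -gmulfM !mulg1.
Qed.

Lemma strongly_Estar_unitary_Estar_unitary :
  strongly_Estar_unitary z -> Estar_unitary z.
Proof.
move=> [V [sigma [[psigma _] pure]]] t e ee e0 [f ff ef].
have tf0 : t * f <> z by rewrite -ef.
have t0 : t <> z by move=> tz; apply: tf0; rewrite tz mul0s.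
have f0 : f <> z by move=> fz; apply: tf0; rewrite fz muls0.
apply/(pure _ t0); have := psigma _ _ tf0.
by rewrite -ef (pure _ e0).2 // (pure _ f0).2 // mulg1 => <-.
Qed.

End UniversalGroup.

(** * Free actions and equivariant bijections *)

Section Actions.
Variable G : groupType.

Definition left_action (Z : Type) (act : G -> Z -> Z) : Prop :=
  (forall x, act 1 x = x) /\ forall g h x, act (g * h) x = act g (act h x).

Definition free_action (Z : Type) (act : G -> Z -> Z) : Prop :=
  forall g x, act g x = x -> g = 1.

(** A free $G$-set is a union of copies of $G$: [rep x] is a chosen point of the
   orbit of [x], and [tr x] the coordinate of [x] in that orbit, which freeness
   makes equivariant. *)
Lemma free_action_transversal (Z : Type) (act : G -> Z -> Z) :
  left_action act -> free_action act ->
  exists (rep : Z -> Z) (tr : Z -> G),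
    [/\ forall x, act (tr x) (rep x) = x,
        forall g x, rep (act g x) = rep x &
        forall g x, tr (act g x) = g * tr x].
Proof.
move=> [act1 actM] free.
pose orb (x : Z) : pred {classic Z} := fun y => `[< exists g, act g y = x >].
pose rep (x : Z) : Z := choose (orb x) (x : {classic Z}).
have orbx x : orb x x by apply/asboolP; exists 1; rewrite act1.
have orbE g x : orb (act g x) =1 orb x.
  move=> y; apply/asboolP/asboolP => -[h hy]; last first.
    by exists (g * h); rewrite actM hy.
  by exists (g^-1 * h); rewrite actM hy -actM mulVg act1.
have repE g x : rep (act g x) = rep x.
  rewrite /rep (eq_choose (orbE g x)).
  have oax : orb x (act g x) by rewrite -(orbE g x) orbx.
  exact (@choose_id {classic Z} (orb x) _ _ oax (orbx x)).
have ex_tr x : exists g, act g (rep x) = x.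
  by apply/asboolP; exact (@chooseP {classic Z} (orb x) x (orbx x)).
have [tr trE] := choice ex_tr; exists rep, tr; split=> // g x.
apply/(@mulgI _ (tr (act g x))^-1); rewrite mulVg; apply/esym.
apply: (free _ (rep x)).
have E : act (tr (act g x)) (rep x) = act g x by rewrite -(repE g) trE.
by rewrite 2!actM trE -[X in act _ X]E -actM mulVg act1.
Qed.

Section CantorBernstein.
Variables (P Q : Type) (f : P -> Q) (g : Q -> P).

(** The points whose backward orbit, under $g^{-1}$ and $f^{-1}$ in turn, ends
   outside the range of $g$; the Cantor-Bernstein bijection follows $f$ on them
   and $g^{-1}$ elsewhere. *)
Inductive cb_forward : P -> Prop :=
| cb_forward_base x : (forall y, g y <> x) -> cb_forward x
| cb_forward_step x : cb_forward x -> cb_forward (g (f x)).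

(** The usual bijection is equivariant, because the set [cb_forward] is
   invariant under the action.  The last clause says how the bijection is glued
   from $f$ and $g$; it gives $F = f$ outside the range of $g$. *)
Lemma equivariant_Cantor_Bernstein (aP : G -> P -> P) (aQ : G -> Q -> Q) :
  left_action aP -> left_action aQ ->
  (forall k x, f (aP k x) = aQ k (f x)) ->
  (forall k y, g (aQ k y) = aP k (g y)) ->
  injective f -> injective g ->
  exists F : P -> Q,
    [/\ forall k x, F (aP k x) = aQ k (F x),
        injective F,
        forall y, exists x, F x = y &
        forall x, F x = f x \/ g (F x) = x].
Proof.
move=> [aP1 aPM] [aQ1 aQM] fE gE fI gI.
have exF x : exists y,
    (cb_forward x /\ y = f x) \/ (~ cb_forward x /\ g y = x).
  have [Cx|nCx] := pselect (cb_forward x); first by exists (f x); left.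
  have [[y gy]|nx] := pselect (exists y, g y = x); first by exists y; right.
  by case: nCx; constructor=> y gy; apply: nx; exists y.
have [F FE] := choice exF.
have Ca k x : cb_forward x -> cb_forward (aP k x).
  elim=> {x} [x nx|x _ Cx]; last by rewrite -gE -fE; exact: cb_forward_step.
  constructor=> y gy; apply: (nx (aQ k^-1 y)).
  by rewrite gE gy -aPM mulVg aP1.
exists F; split=> [k x|x x'|y|x]; last by case: (FE x) => -[]; auto.
- case: (FE x) => -[Cx Fx]; case: (FE (aP k x)) => -[Cax Fax].
  + by rewrite Fax Fx fE.
  + by case: Cax; apply: Ca.
  + by case: Cx; rewrite -(aP1 x) -(mulVg k) aPM; apply: Ca.
  + by apply: gI; rewrite Fax gE Fx.
- case: (FE x) => -[Cx Fx]; case: (FE x') => -[Cx' Fx'] E.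
  + by apply: fI; rewrite -Fx -Fx'.
  + by case: Cx'; rewrite -Fx' -E Fx; exact: cb_forward_step.
  + by case: Cx; rewrite -Fx E Fx'; exact: cb_forward_step.
  + by rewrite -Fx -Fx' E.
- case: (FE (g y)) => -[Cgy Fgy]; last by exists (g y); apply: gI.
  move E : (g y) Cgy => x Cx; case: Cx E => [x' nx /nx//|x' Cx' /gI ->].
  by exists x'; case: (FE x') => -[].
Qed.

End CantorBernstein.
End Actions.

(** * The symmetric group of a type *)

Section Symmetric.
Variable Y : Type.

Record sym := Sym {
  sym_fun :> Y -> Y;
  sym_inv_fun : Y -> Y;
  sym_funK : cancel sym_fun sym_inv_fun;
  sym_inv_funK : cancel sym_inv_fun sym_fun }.

Lemma sym_eq (a b : sym) : a =1 b -> a = b.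
Proof.
case: a b => [f f' fK f'K] [g g' gK g'K] /= /funext fg; move: fK f'K.
rewrite fg => fK f'K; have E : f' = g'.
  by apply/funext => y; rewrite -[y in LHS]g'K fK.
by move: fK f'K; rewrite E => fK f'K; congr Sym; exact: Prop_irrelevance.
Qed.

Definition sym1 := @Sym id id (fun=> erefl) (fun=> erefl).
Definition sym_mul (a b : sym) :=
  Sym (can_comp (@sym_funK a) (@sym_funK b))
      (can_comp (@sym_inv_funK b) (@sym_inv_funK a)).
Definition sym_inv (a : sym) := Sym (@sym_inv_funK a) (@sym_funK a).

Lemma sym_mulA : associative sym_mul.
Proof. by move=> a b c; apply: sym_eq. Qed.
Lemma sym_mul1g : left_id sym1 sym_mul.
Proof. by move=> a; apply: sym_eq. Qed.
Lemma sym_mulg1 : right_id sym1 sym_mul.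
Proof. by move=> a; apply: sym_eq. Qed.
Lemma sym_mulVg : left_inverse sym1 sym_inv sym_mul.
Proof. by move=> a; apply: sym_eq => y /=; rewrite sym_funK. Qed.
Lemma sym_mulgV : right_inverse sym1 sym_inv sym_mul.
Proof. by move=> a; apply: sym_eq => y /=; rewrite sym_inv_funK. Qed.

HB.instance Definition _ := gen_eqMixin sym.
HB.instance Definition _ := gen_choiceMixin sym.
HB.instance Definition _ := isGroup.Build sym
  sym_mulA sym_mul1g sym_mulg1 sym_mulVg sym_mulgV.

End Symmetric.

Section SelfSimilar.
Variables (G : groupType) (U : ultragraph) (X : self_similar G U).
Implicit Types (g h : G) (e : edge U) (p q : seq (edge U)).

(** * Pseudo freeness on edges *)

(** The element acting on the $i$-th edge is the cocycle value of the preceding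
   edges.  These values start at $g \ne 1$ and end at 1, and the last nontrivial
   one strongly fixes its edge. *)
Lemma strongly_fixed_edge g p : g <> 1 -> strongly_fixed X g p ->
  exists k e, [/\ k <> 1, acte X k e = e & coc X k e = 1].
Proof.
elim: p g => [g g1 [_ /g1]//|e p IH g g1 [/= [ge gp] cp]].
have [c1|c1] := pselect (coc X g e = 1); first by exists g, e.
exact: (IH (coc X g e)).
Qed.

Lemma pseudo_free_edge g e :
  pseudo_free X -> acte X g e = e -> coc X g e = 1 -> g = 1.
Proof.
move=> pf ge c1; have [//|g1] := pselect (g = 1).
by case: (pf g g1 [:: e]) => //; split=> //=; rewrite ge.
Qed.

(** * Embedding the monoid of words and group elements in a group *)

Fixpoint path_val (H : groupType) (tau : edge U -> H) p : H :=
  if p is e :: q then tau e * path_val tau q else 1.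

Section Realization.

(** [M] is the Zappa-Szep product of the free monoid on the edges with [G], so
   its elements are not restricted to composable sequences of edges.  [T] is
   built so that [code] embeds [edge U * Y] in it. *)
Let M : Type := (seq (edge U) * G)%type.
Let T : Type := seq (edge U * (M + G)).
Let Y : Type := (M + T * G)%type.

Let actY g (y : Y) : Y :=
  match y with
  | inl (p, h) => inl (actp X g p, cocp X g p * h)
  | inr (t, h) => inr (t, g * h)
  end.

(** Injective since the head of the list tells the two summands apart. *)
Let code (x : edge U * Y) : T :=
  match x with
  | (e, inl m) => [:: (e, inl m)]
  | (e, inr (t, h)) => (e, inr h) :: t
  end.

(** A map $F$ over the edges is a family of maps $F_e$ of $Y$; it is equivariant
   from [twist] to [diag] exactly when $g F_e = F_{g e} \varphi(g, e)$. *)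
Let diag g (x : edge U * Y) := (acte X g x.1, actY g x.2).
Let twist g (x : edge U * Y) := (acte X g x.1, actY (coc X g x.1) x.2).

Lemma code_inj : injective code.
Proof. by move=> [e [m|[t h]]] [e' [m'|[t' h']]] //= [-> -> ]// ->. Qed.

Lemma cocp1 p : cocp X 1 p = 1.
Proof. by elim: p => //= e p; rewrite coc1. Qed.

Lemma actp1 p : actp X 1 p = p.
Proof. by elim: p => //= e p IH; rewrite acte1 coc1 IH. Qed.

Lemma actpM g h p : actp X (g * h) p = actp X g (actp X h p).
Proof. by elim: p g h => //= e p IH g h; rewrite acteM cocM IH. Qed.

Lemma cocpM g h p : cocp X (g * h) p = cocp X g (actp X h p) * cocp X h p.
Proof. by elim: p g h => //= e p IH g h; rewrite cocM IH. Qed.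

Lemma actY_action : left_action actY.
Proof.
split=> [[[p h]|[t h]]|g k [[p h]|[t h]]] /=.
- by rewrite actp1 cocp1 mul1g.
- by rewrite mul1g.
- by rewrite actpM cocpM mulgA.
- by rewrite mulgA.
Qed.

Lemma diag_action : left_action diag.
Proof.
have [a1 aM] := actY_action.
by split=> [[e y]|g k [e y]]; rewrite /diag /= ?acte1 ?a1 // acteM aM.
Qed.

Lemma twist_action : left_action twist.
Proof.
have [a1 aM] := actY_action.
split=> [[e y]|g k [e y]]; rewrite /twist /= ?acte1 ?coc1 ?a1 //.
by rewrite acteM cocM aM.
Qed.

Hypothesis pf : pseudo_free X.

Lemma actY_free : free_action actY.
Proof.
move=> g [[p h]|[t h]] /= [] => [gp E|E]; last first.
  by apply: (@mulIg _ h); rewrite mul1g.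
have c1 : cocp X g p = 1 by apply: (@mulIg _ h); rewrite mul1g.
have [//|g1] := pselect (g = 1).
have [k [e [k1 ke ce]]] := strongly_fixed_edge g1 (conj gp c1).
by case: k1; exact: pseudo_free_edge ce.
Qed.

Lemma diag_free : free_action diag.
Proof. by move=> g [e y] [_]; exact: actY_free. Qed.

Lemma twist_free : free_action twist.
Proof. by move=> g [e y] [ge /actY_free]; exact: pseudo_free_edge. Qed.

(** The component $F_e$ of $F$ is a bijection of $Y$ that extends left
   multiplication by $e$ on $M$. *)
Lemma exists_equivariant_extension : exists F : edge U * Y -> edge U * Y,
  [/\ forall g x, F (twist g x) = diag g (F x),
      injective F,
      forall y, exists x, F x = y,
      forall x, (F x).1 = x.1 &
      forall e p h, F (e, inl (p, h)) = (e, inl (e :: p, h))].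
Proof.
have [rep [tr [trE repE trM]]] :=
  free_action_transversal twist_action twist_free.
have [rep' [tr' [trE' repE' trM']]] :=
  free_action_transversal diag_action diag_free.
pose f (x : edge U * Y) : edge U * Y :=
  match x with
  | (e, inl (p, h)) => (e, inl (e :: p, h))
  | (e, inr _) => (e, inr (code (rep x), tr x))
  end.
(* The last coordinate must transform by $\varphi(k, e)$ under $k$; transporting
   the cocycle from the orbit representative achieves this, and pseudo freeness
   makes the resulting map injective. *)
pose g (x : edge U * Y) : edge U * Y :=
  (x.1, inr (code (rep' x), coc X (tr' x) (rep' x).1)).
have fE k x : f (twist k x) = diag k (f x).
  case: x => [e [[p h]|[t h]]] //; set x := (e, inr (t, h)).
  rewrite -[LHS]/(acte X k e, inr (code (rep (twist k x)), tr (twist k x))).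
  by rewrite repE trM.
have gE k x : g (diag k x) = twist k (g x).
  have x1 : acte X (tr' x) (rep' x).1 = x.1 by exact: (congr1 fst (trE' x)).
  by rewrite /g repE' trM' cocM x1.
have fI : injective f.
  move=> [e [[p h]|[t h]]] [e' [[p' h']|[t' h']]] //=.
    by case=> -> _ -> ->.
  by case=> _ /code_inj Er Et; rewrite -[LHS]trE -[RHS]trE Er Et.
have gI : injective g.
  move=> x x' [Ex /code_inj Er Ec]; rewrite -(trE' x) -(trE' x') Er.
  congr diag; apply: (@mulgI _ (tr' x')^-1); rewrite mulVg.
  set r := rep' x' in Er Ec *.
  have Ee : acte X (tr' x) r.1 = acte X (tr' x') r.1.
    by rewrite -[LHS]/((diag _ r).1) -[RHS]/((diag _ r).1) -{1}Er !trE'.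
  have Ek : acte X ((tr' x')^-1 * tr' x) r.1 = r.1.
    by rewrite acteM Ee -acteM mulVg acte1.
  have Ek1 : coc X ((tr' x')^-1 * tr' x) r.1 = 1.
    apply: (@mulgI _ (coc X (tr' x') r.1)).
    by rewrite -{1}Ek -cocM mulgA mulgV mul1g mulg1 -Ec Er.
  exact: (pseudo_free_edge pf Ek Ek1).
have [F [FE FI FS Ffg]] :=
  equivariant_Cantor_Bernstein twist_action diag_action fE gE fI gI.
exists F; split=> // [x|e p h]; last by case: (Ffg (e, inl (p, h))).
case: (Ffg x) => [->|gF]; first by case: x => [e [[]|]].
by rewrite -[in RHS]gF.
Qed.

(** The universal group of the self-similar action contains the monoid $M$.  The
   group is realized by permutations of $Y$, and elements of $M$ are told apart
   by their effect on the unit of $M$. *)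
Lemma pseudo_free_realization :
  exists (H : groupType) (rho : G -> H) (tau : edge U -> H),
    [/\ {morph rho : g h / g * h},
        forall g e, rho g * tau e = tau (acte X g e) * rho (coc X g e) &
        forall p q g, path_val tau p * rho g = path_val tau q ->
          p = q /\ g = 1].
Proof.
have [F [FE FI FS F1 Fp]] := exists_equivariant_extension.
have [F' FF'] := choice FS.
have F'F x : F' (F x) = x by apply: FI; rewrite FF'.
have F'1 x : (F' x).1 = x.1 by rewrite -F1 FF'.
have tauK e : cancel (fun y => (F (e, y)).2) (fun y => (F' (e, y)).2).
  by move=> y; rewrite -{1}[e]/((e, y).1) -F1 -surjective_pairing F'F.
have tauVK e : cancel (fun y => (F' (e, y)).2) (fun y => (F (e, y)).2).
  by move=> y; rewrite -{1}[e]/((e, y).1) -F'1 -surjective_pairing FF'.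
have [a1 aM] := actY_action.
have rhoK g : cancel (actY g) (actY g^-1) by move=> y; rewrite -aM mulVg a1.
have rhoVK g : cancel (actY g^-1) (actY g) by move=> y; rewrite -aM mulgV a1.
pose tau e : sym Y := Sym (tauK e) (tauVK e).
pose rho g : sym Y := Sym (rhoK g) (rhoVK g).
exists (sym Y), rho, tau; split=> [g h|g e|p q g].
- by apply: sym_eq => y; exact: aM.
- by apply: sym_eq => y; rewrite /= -[RHS]/((F (twist g (e, y))).2) FE.
- have val p' h : path_val tau p' (inl ([::], h) : Y) = inl (p', h).
    by elim: p' => //= e p' ->; rewrite Fp.
  move=> /(congr1 (fun a : sym Y => a (inl ([::], 1)))) /=.
  by rewrite /= mulg1 !val => -[].
Qed.

End Realization.

(** * Quadruples: idempotents and values in a group *)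

Lemma sgu_mul0 (s : sgu X) : sgu0 X * s = sgu0 X.
Proof. by []. Qed.

Lemma sgu_mulr0 (s : sgu X) : s * sgu0 X = sgu0 X.
Proof. by case: s. Qed.

Lemma sgu_mulE (x y : sgu_nonzero X) :
  (Some x : sgu X) * (Some y : sgu X) =
  if quad_mul X x y is Some z then sgu_of_quad X z else sgu0 X.
Proof. by []. Qed.

Lemma sgu_of_quadE (x : sgu_nonzero X) : sgu_of_quad X x = Some x.
Proof.
case: x => x vx; rewrite /sgu_of_quad /=; case: pselect => // vx'.
by congr (Some (SguNonzero _)); exact: Prop_irrelevance.
Qed.

Lemma sgu_mul_neq0 (s t : sgu X) : s * t <> sgu0 X ->
  exists x y z : sgu_nonzero X,
    [/\ s = Some x, t = Some y, s * t = Some z &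
        quad_mul X x y = Some (z : quad G U)].
Proof.
case: s t => [x|//] [y|//]; rewrite sgu_mulE.
case E: quad_mul => [z|//]; rewrite /sgu_of_quad; case: pselect => // vz _.
by exists x, y, (SguNonzero vz).
Qed.

Lemma sgu_idem_diag (x : sgu_nonzero X) :
  q_left x = q_right x -> q_elt x = 1 -> idem (Some x : sgu X).
Proof.
move=> lr g1; rewrite /idem sgu_mulE.
suff -> : quad_mul X x x = Some (sgu_quad x) by exact: sgu_of_quadE.
case: x lr g1 => [[a A g b]] [_ _ _ A0 _] /= <- ->; rewrite drop_size.
case: asboolP => [[]//|_]; case: asboolP => [[]//|_].
rewrite acts1 setIid mulg1.
by case: asboolP => // -[].
Qed.

Lemma sgu_idem_elt (x : sgu_nonzero X) :
  q_left x = q_right x -> idem (Some x : sgu X) -> q_elt x = 1.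
Proof.
move=> lr ix.
have : (Some x : sgu X) * (Some x : sgu X) <> sgu0 X by rewrite ix.
move=> /sgu_mul_neq0[_ [_ [z [[<-] [<-] xz]]]]; move: xz; rewrite ix => -[<-].
case: x lr {ix z} => [[a A g b] /= _] <-; rewrite drop_size.
case: asboolP => [[]//|_]; case: asboolP => [[]//|_].
case: asboolP => // _ [_ gg]; apply: (@mulgI _ g).
by rewrite gg mulg1.
Qed.

(** An edge strongly fixed by $k \ne 1$ puts the idempotent $(e, s(e), 1, e)$
   below the element $(\omega, r(e), k, \omega)$, which is not idempotent.
   Passing to a single edge matters: for it $s(e)$ is invariant under $k$, which
   keeps the product of the two nonzero, whereas for a longer path $\alpha$ the
   set $k \cdot s(\alpha)$ may miss $s(\alpha)$. *)
Lemma Estar_unitary_pseudo_free : Estar_unitary (sgu0 X) -> pseudo_free X.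
Proof.
move=> Eu g g1 p _ /(strongly_fixed_edge g1)[k [e [k1 ke ce]]].
have kr : acts X k (rng e) = rng e by rewrite -[RHS](congr1 _ ke) acte_rng.
have ks : acts X k (src e) = src e by rewrite -[RHS](congr1 _ ke) acte_src.
have vt : quad_valid X (Quad [::] (rng e) k [::]).
  have [v re] := rng_singleton e; rewrite /= re; split=> //.
  - exact: gvertex_set1.
  - by exists v.
  - move=> w _; split=> //; exists (actv X k^-1 w) => //.
    by rewrite -actvM mulgV actv1.
have vf : quad_valid X (Quad [:: e] (src e) 1 [:: e]).
  rewrite /= acts1 setIid; split=> //; first exact: gvertex_src.
  exact: src_nonempty.
pose t := SguNonzero vt; pose f := SguNonzero vf.
have ff : idem (Some f : sgu X) by exact: sgu_idem_diag.
have tf : (Some t : sgu X) * (Some f : sgu X) = Some f.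
  rewrite sgu_mulE /= kr ke ce ks acts1 setIid mulg1.
  by case: asboolP => [_|[]]; [exact: (sgu_of_quadE f)|split].
have it : idem (Some t : sgu X).
  by apply: (Eu _ (Some f)) => //; exists (Some f).
exact: k1 (sgu_idem_elt (x := t) erefl it).
Qed.

Lemma path_val_cat (H : groupType) (tau : edge U -> H) p q :
  path_val tau (p ++ q) = path_val tau p * path_val tau q.
Proof. by elim: p => [|e p IH] /=; rewrite ?mul1g // IH mulgA. Qed.

Section QuadValue.
Variables (H : groupType) (rho : G -> H) (tau : edge U -> H).
Hypothesis rhoM : {morph rho : g h / g * h}.
Hypothesis rho_tau :
  forall g e, rho g * tau e = tau (acte X g e) * rho (coc X g e).

Definition quad_val (x : quad G U) : H :=
  path_val tau (q_left x) * rho (q_elt x) * (path_val tau (q_right x))^-1.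

Lemma rho1 : rho 1 = 1.
Proof. by apply: (@mulgI _ (rho 1)); rewrite -rhoM !mulg1. Qed.

Lemma rhoV g : rho g^-1 = (rho g)^-1.
Proof. by apply: (@mulgI _ (rho g)); rewrite -rhoM !mulgV rho1. Qed.

Lemma rho_path_val g p :
  rho g * path_val tau p = path_val tau (actp X g p) * rho (cocp X g p).
Proof.
elim: p g => [|e p IH] g /=; first by rewrite mulg1 mul1g.
by rewrite mulgA rho_tau -!mulgA IH.
Qed.

(** The three cases of the product are the three ways in which
   $\beta^{-1} \gamma$ cancels in $\alpha g \beta^{-1} \gamma h \delta^{-1}$. *)
Lemma quad_val_mul x y z :
  quad_mul X x y = Some z -> quad_val z = quad_val x * quad_val y.
Proof.
case: x y => [a A g b] [c B h d] /=; rewrite /quad_val.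
case: asboolP => [[cE _ _] [<-] /=|_].
  move: (drop _ c) cE => e ->; rewrite !path_val_cat rhoM !mulgA.
  rewrite mulgVK -(mulgA _ (rho g)) rho_path_val.
  by rewrite !mulgA.
case: asboolP => [[bE _ _] [<-] /=|_].
  move: (drop _ b) bE => f ->; rewrite !path_val_cat rhoM rhoV.
  rewrite !invgM !mulgA mulgVK.
  have := rho_path_val h^-1 f; rewrite rhoV.
  move=> /(congr1 (fun x => x^-1)); rewrite !invgM invgK => E.
  by rewrite -(mulgA _ _ (rho h)) E !mulgA.
case: asboolP => [[-> _] [<-] /=|//].
by rewrite rhoM !mulgA mulgVK.
Qed.

Definition sgu_val (s : sgu X) : H := if s is Some x then quad_val x else 1.

Lemma sgu_val_prehom : prehom (sgu0 X) sgu_val.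
Proof.
move=> s t /sgu_mul_neq0[x [y [z [-> -> -> xyz]]]].
exact: quad_val_mul.
Qed.

End QuadValue.

Lemma pseudo_free_strongly_Estar_unitary :
  pseudo_free X -> strongly_Estar_unitary (sgu0 X).
Proof.
move=> pf.
have [H [rho [tau [rhoM rho_tau inj]]]] := pseudo_free_realization pf.
apply: (strongly_Estar_unitary_of_pure sgu_mul0 sgu_mulr0
  (sgu_val_prehom rhoM rho_tau)) => -[x|//] _ /=; rewrite /quad_val => x1.
have [|lr g1] := inj (q_left x) (q_right x) (q_elt x).
  by apply: (@mulIg _ (path_val tau (q_right x))^-1); rewrite x1 mulgV.
exact: sgu_idem_diag.
Qed.

End SelfSimilar.

Theorem theorem10p4 (G : groupType) (U : ultragraph) (X : self_similar G U) :
  [<-> Estar_unitary (sgu0 X);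
       strongly_Estar_unitary (sgu0 X);
       pseudo_free X].
Proof.
have Estar := strongly_Estar_unitary_Estar_unitary (@sgu_mul0 _ _ X)
  (@sgu_mulr0 _ _ X).
tfae=> [Eu|sEu|pf].
- exact/pseudo_free_strongly_Estar_unitary/Estar_unitary_pseudo_free.
- exact/Estar_unitary_pseudo_free/Estar.
- apply: Estar; exact: pseudo_free_strongly_Estar_unitary.
Qed.
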